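(* Run the refinement procedure described in the context at outer iteration $k$. Let $\mathcal F_k$ be the set of indices $r$ of failed trials, let $s_{k,r}$ be the candidate step of trial $r$, let $q_k$ be the number of global Jacobian--vector products used, and let $H_k=\nabla F(v_k)-\nabla F_1(v_k)-B_k$. Then $$\sum_{r\in\mathcal F_k}\|s_{k,r}\|^2<\frac{4}{L_1^2}\|H_k\|_{\mathrm F}^2 .$$ If no test fails, then $q_k\le1$. Otherwise, writing $\tau_k:=\min_{r\in\mathcal F_k}\|s_{k,r}\|$ for the length of the shortest failed step, $$q_k\le\min\left\{d,\;1+\frac{4\|H_k\|_{\mathrm F}^2}{L_1^2\tau_k^2}\right\}.$$
   Context: Norms are Euclidean; $\|\cdot\|_{\mathrm{op}}$ and $\|\cdot\|_{\mathrm F}$ are the operator and Frobenius norms. $\mathcal Z\subset\mathbb R^d$ is nonempty, compact and convex. $F=\sum_{i=1}^M w_iF_i$ with $w_i>0$, $\sum_i w_i=1$, all $F_i:\mathcal Z\to\mathbb R^d$ continuously differentiable; $F$ is monotone on $\mathcal Z$, that is, $\langle F(x)-F(y),x-y\rangle\ge0$ for all $x,y\in\mathcal Z$, and $\|\nabla F(x)-\nabla F(y)\|_{\mathrm{op}}\le L_1\|x-y\|$ for all $x,y\in\mathcal Z$, $L_1>0$. $\beta=\sup_{z\in\mathcal Z}\|\nabla F(z)-\nabla F_1(z)\|_{\mathrm{op}}$. $G:=F-F_1$; $v_k\in\mathcal Z$ is the current outer point. $B_k=\Pi^{\mathrm F}_{\mathcal B_\beta}(YS^\dagger)$, where $S=[s_1,\dots,s_m]$,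 $Y=[y_1,\dots,y_m]$ are stored residual secants $s_j=b_j-a_j$, $y_j=G(b_j)-G(a_j)$, $a_j,b_j\in\mathcal Z$; $S^\dagger$ is the Moore--Penrose pseudoinverse ($YS^\dagger$ is replaced by $0$ if $m=0$); $\mathcal B_\beta=\{B\in\mathbb R^{d\times d}:\|B\|_{\mathrm{op}}\le\beta\}$ and $\Pi^{\mathrm F}_{\mathcal B_\beta}$ is the Frobenius metric projection onto it. Inner solution for a matrix $J$ at $v$ and level $\delta$: a point $x\in\mathcal Z$ with $\sup_{z\in\mathcal Z}\langle\Omega_{v,J,\delta}(x),x-z\rangle\le\frac{L_1}{2}\|x-v\|^3+\delta\|x-v\|^2$, where $\Omega_{v,J,\delta}(x)=F(v)+J(x-v)+(10\delta+5L_1\|x-v\|)(x-v)$. Refinement procedure at outer iteration $k$. Start with $r=0$, $P_{k,0}=0$, $C_{k,0}=0$. Repeat: set $J_{k,r}=\nabla F_1(v_k)+B_k+C_{k,r}$; compute an inner solution $x_{k,r}$ for $J_{k,r}$ at $v_k$ and level $2\beta$; set $s_{k,r}=x_{k,r}-v_k$. If $r=d$, return $x_{k,r}$ (no product is used in this trial). Otherwise use one global Jacobian--vector product $g=\nabla F(v_k)s_{k,r}$ and set $e_{k,r}=g-J_{k,r}s_{k,r}$. If $\|e_{k,r}\|\le\frac{L_1}{2}\|s_{k,r}\|^2$ (test passed), return $x_{k,r}$. Otherwise the trial (test) $r$ fails: set $w_{k,r}=(I-P_{k,r})s_{k,r}$, $u_{k,r+1}=w_{k,r}/\|w_{k,r}\|$,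 $h_{k,r+1}=e_{k,r}/\|w_{k,r}\|$, $P_{k,r+1}=P_{k,r}+u_{k,r+1}u_{k,r+1}^{\mathsf T}$, $C_{k,r+1}=C_{k,r}+h_{k,r+1}u_{k,r+1}^{\mathsf T}$, and increase $r$ by one.
   Formalization: The strict bound on the sum of squared failed steps is stated only for H_k ≠ 0; when H_k = 0 it would read 0 < 0, and it is proved instead that no test fails. *)

(* Defs.v *)
From HB Require Import structures.
From mathcomp Require Import all_boot all_order all_algebra.
From mathcomp Require Import all_classical all_reals all_analysis.

Set Implicit Arguments.
Unset Strict Implicit.
Unset Printing Implicit Defensive.

Import Order.TTheory GRing.Theory Num.Theory.
Import numFieldNormedType.Exports.

Local Open Scope ring_scope.

(* The library norm `|A| on matrices is the max norm, hence the norms below.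
   On column vectors [frob] is the Euclidean norm. *)
Definition frob (R : realType) (m n : nat) (A : 'M[R]_(m, n)) : R :=
  Num.sqrt (\sum_i \sum_j A i j ^+ 2).

Notation enorm x := (frob (n := 1) x) (only parsing).

Definition dot (R : realType) (d : nat) (x y : 'cV[R]_d) : R :=
  \sum_i x i 0 * y i 0.

Definition opnorm (R : realType) (m n : nat) (A : 'M[R]_(m, n)) : R :=
  sup [set enorm (A *m x) | x in [set x : 'cV[R]_n | enorm x <= 1]]%classic.

(* [f] is continuously differentiable on [Z] with Jacobian field [Df]; the
   derivative is taken relative to [Z], so that [f] matters only on [Z].  When
   [f] is C^1 on an open neighbourhood of [Z], its usual Jacobian is such a
   [Df]; when [Z] has empty interior [Df] need not be unique. *)
Definition C1_on (R : realType) (d : nat) (Z : set 'cV[R]_d)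
    (f : 'cV[R]_d -> 'cV[R]_d) (Df : 'cV[R]_d -> 'M[R]_d) : Prop :=
  (forall x, Z x -> forall eps : R, 0 < eps ->
     \forall y \near within Z (nbhs x),
       enorm (f y - f x - Df x *m (y - x)) <= eps * enorm (y - x)) /\
  {within Z, continuous Df}%classic.

Definition monotone_on (R : realType) (d : nat) (Z : set 'cV[R]_d)
    (f : 'cV[R]_d -> 'cV[R]_d) : Prop :=
  forall x y, Z x -> Z y -> 0 <= dot (f x - f y) (x - y).

(* The Penrose equations over the reals; they determine [X]. *)
Definition moore_penrose (R : realType) (m n : nat)
    (A : 'M[R]_(m, n)) (X : 'M[R]_(n, m)) : Prop :=
  [/\ A *m X *m A = A, X *m A *m X = X,
      (A *m X)^T = A *m X & (X *m A)^T = X *m A].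

Definition frob_projection (R : realType) (d : nat) (beta : R)
    (A B : 'M[R]_d) : Prop :=
  opnorm B <= beta /\
  forall X : 'M[R]_d, opnorm X <= beta -> frob (A - B) <= frob (A - X).

Section Refinement.

Variables (R : realType) (d : nat) (Z : set 'cV[R]_d) (L1 : R).
Implicit Types (J P C : 'M[R]_d) (x s v : 'cV[R]_d) (r n : nat).

(* [Fv] stands for F(v). *)
Definition Omega (Fv v : 'cV[R]_d) J (delta : R) x : 'cV[R]_d :=
  Fv + J *m (x - v) + (10 * delta + 5 * L1 * enorm (x - v)) *: (x - v).

Definition inner_solution (Fv v : 'cV[R]_d) J (delta : R) x : Prop :=
  Z x /\
  sup [set dot (Omega Fv v J delta x) (x - z) | z in Z]%classic
    <= L1 / 2 * enorm (x - v) ^+ 3 + delta * enorm (x - v) ^+ 2.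

(* [A] is the global Jacobian at the outer point [v], [J0] the uncorrected
   model matrix, and [xs r] the candidate chosen in trial [r]; inner solutions
   need not be unique, so the candidates are an input. *)
Variables (Fv v : 'cV[R]_d) (A J0 : 'M[R]_d) (beta : R) (xs : nat -> 'cV[R]_d).

Definition step r : 'cV[R]_d := xs r - v.

Fixpoint state r : 'M[R]_d * 'M[R]_d :=
  if r is r'.+1 then
    let: (P, C) := state r' in
    let s := step r' in
    let e := A *m s - (J0 + C) *m s in
    let w := (1%:M - P) *m s in
    let u := (enorm w)^-1 *: w in
    let h := (enorm w)^-1 *: e in
    (P + u *m u^T, C + h *m u^T)
  else (0, 0).

Definition model r : 'M[R]_d := J0 + (state r).2.

Definition residual r : 'cV[R]_d := A *m step r - model r *m step r.

Definition test_passes r : bool :=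
  enorm (residual r) <= L1 / 2 * enorm (step r) ^+ 2.

(* The procedure executes exactly the trials 0, ..., n and returns [xs n]. *)
Definition refinement_run n : Prop :=
  [/\ (n <= d)%N,
      forall r, (r <= n)%N -> inner_solution Fv v (model r) (2 * beta) (xs r),
      forall r, (r < n)%N -> ~~ test_passes r
    & n = d \/ test_passes n].

(* Trial [d] performs no test and uses no Jacobian-vector product; every other
   executed trial performs one test and uses one product. *)
Definition failed_trials n : {set 'I_n.+1} :=
  [set r : 'I_n.+1 | (nat_of_ord r != d) && ~~ test_passes r]%SET.

Definition jvp_count n : nat := #|[set r : 'I_n.+1 | nat_of_ord r != d]%SET|.

End Refinement.

(* Main.v *)
Require Import Defs.
From HB Require Import structures.
From mathcomp Require Import all_boot all_order all_algebra.
From mathcomp Require Import all_classical all_reals all_analysis.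
From mathcomp Require Import ring.

Set Implicit Arguments.
Unset Strict Implicit.
Unset Printing Implicit Defensive.

Import Order.TTheory GRing.Theory Num.Theory.
Import numFieldNormedType.Exports.

Local Open Scope ring_scope.

(** The bounds are a statement about the deficit [D r], the Jacobian [A] minus
the model matrix of trial [r], whose initial value is [H].

A failed test adds to the model a rank-one correction that makes it exact along
a new unit direction [u], orthogonal to the previous ones.  In terms of the
deficit, [D r] vanishes on the span of the directions found so far (the range of
the orthogonal projector [P]), so the component [w] of the step orthogonal to
that span satisfies [D r *m w = D r *m s = e].  Hence the correction vector
[e / |w|] is [D r *m u], and the update is
[D (r + 1) = D r *m (1 - u u^T)]
([deficit_succ], [deficit_projector]): the deficit is deflated along [u] and the
invariant is preserved.  Pythagoras for the Frobenius norm
([frob_sqr_projectorr]) then says that each failure removes exactly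
[|D r u| ^ 2] from the squared Frobenius norm, so these losses sum to at most
[frob H ^ 2] ([sum_loss]).

A failed test means [|e| > L1 / 2 * |s| ^ 2], and [|w| <= |s|] because [w] is a
projection of [s]; so [|D r u| = |e| / |w| > L1 / 2 * |s|] ([failed_loss]).
Summing over the failed trials gives the first bound ([sum_steps_lt]).  The
failed trials of a run with last trial [n] are exactly the trials before [n],
so the number of products is at most one more than the number of failures, and
the count follows by bounding every failed step below by the shortest one.  When
no test fails the sum is empty and the strict bound only says [H != 0]; when
[H = 0] the strict bound rules out every failure. *)

(** * Frobenius norm and orthogonal projectors *)

Section FrobeniusNorm.
Variable R : realType.

Lemma frob_ge0 m n (A : 'M[R]_(m, n)) : 0 <= frob A.
Proof. exact: sqrtr_ge0. Qed.

Lemma frob_sqr_trace m n (A : 'M[R]_(m, n)) : frob A ^+ 2 = \tr (A *m A^T).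
Proof.
rewrite sqr_sqrtr; last by do 2 (apply: sumr_ge0 => ? _); exact: sqr_ge0.
by apply: eq_bigr => i _; rewrite mxE; apply: eq_bigr => j _; rewrite mxE expr2.
Qed.

Lemma frob_eq0 m n (A : 'M[R]_(m, n)) : (frob A == 0) = (A == 0).
Proof.
apply/eqP/eqP => [A0|->]; last first.
  by apply/eqP; rewrite -sqrf_eq0 frob_sqr_trace mul0mx mxtrace0.
have sq0 : \sum_i \sum_j A i j ^+ 2 = 0.
  apply/eqP; rewrite eq_le -sqrtr_eq0 [X in X == 0]A0 eqxx.
  by do 2 (apply: sumr_ge0 => ? _); exact: sqr_ge0.
have row0 i : \sum_j A i j ^+ 2 = 0.
  apply: (psumr_eq0P _ sq0) => // k _; apply: sumr_ge0 => ? _; exact: sqr_ge0.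
apply/matrixP => i j; rewrite mxE; apply/eqP; rewrite -sqrf_eq0; apply/eqP.
by apply: (psumr_eq0P _ (row0 i)) => // k _; exact: sqr_ge0.
Qed.

Lemma frob_gt0 m n (A : 'M[R]_(m, n)) : (0 < frob A) = (A != 0).
Proof. by rewrite lt_def frob_eq0 frob_ge0 andbT. Qed.

Lemma frob_sqrZ m n c (A : 'M[R]_(m, n)) :
  frob (c *: A) ^+ 2 = c ^+ 2 * frob A ^+ 2.
Proof.
by rewrite !frob_sqr_trace linearZ /= -scalemxAl -scalemxAr !mxtraceZ mulrA expr2.
Qed.

Lemma frob_sqr_trmx m n (A : 'M[R]_(m, n)) : frob A^T ^+ 2 = frob A ^+ 2.
Proof. by rewrite !frob_sqr_trace trmxK mxtrace_mulC. Qed.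

Definition orthogonal_projector n (P : 'M[R]_n) : Prop :=
  P^T = P /\ P *m P = P.

Lemma orthogonal_projectorC n (P : 'M[R]_n) :
  orthogonal_projector P -> orthogonal_projector (1%:M - P).
Proof.
move=> [PT PP]; split; first by rewrite linearB /= trmx1 PT.
by rewrite mulmxBl mul1mx mulmxBr mulmx1 PP subrr subr0.
Qed.

(** Pythagoras: the rows of [A *m P] and of [A *m (1%:M - P)] are orthogonal, so
the cross terms of the trace vanish. *)
Lemma frob_sqr_projectorr m n (A : 'M[R]_(m, n)) (P : 'M[R]_n) :
  orthogonal_projector P ->
  frob A ^+ 2 = frob (A *m P) ^+ 2 + frob (A *m (1%:M - P)) ^+ 2.
Proof.
move=> oP; have [QT QQ] := orthogonal_projectorC oP; have [PT PP] := oP.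
rewrite !frob_sqr_trace !trmx_mul PT QT -!mulmxA.
rewrite (mulmxA P) (mulmxA (1%:M - P)) PP QQ -mxtraceD -mulmxDr -mulmxDl.
by rewrite addrC subrK mul1mx.
Qed.

Lemma frob_projectorl_le m n (A : 'M[R]_(m, n)) (P : 'M[R]_m) :
  orthogonal_projector P -> frob (P *m A) <= frob A.
Proof.
move=> oP; rewrite -(@ler_pXn2r _ 2) ?nnegrE ?frob_ge0 //.
rewrite -frob_sqr_trmx trmx_mul oP.1 -[leRHS]frob_sqr_trmx.
by rewrite [leRHS](frob_sqr_projectorr _ oP) lerDl sqr_ge0.
Qed.

Lemma unit_cV n (w : 'cV[R]_n) : w != 0 ->
  let u := (enorm w)^-1 *: w in u^T *m u = 1%:M.
Proof.
move=> w0 /=; set u := _ *: w.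
rewrite [LHS]mx11_scalar; congr (_%:M).
have -> : (u^T *m u) 0 0 = frob u ^+ 2.
  by rewrite frob_sqr_trace mxtrace_mulC /mxtrace big_ord1.
by rewrite frob_sqrZ exprVn mulVf // sqrf_eq0 frob_eq0.
Qed.

Lemma projector_line n (u : 'cV[R]_n) :
  u^T *m u = 1%:M -> orthogonal_projector (u *m u^T).
Proof.
move=> uu; split; first by rewrite trmx_mul trmxK.
by rewrite mulmxA -(mulmxA u) uu mulmx1.
Qed.

Lemma frob_sqr_mul_line m n (A : 'M[R]_(m, n)) (u : 'cV[R]_n) :
  u^T *m u = 1%:M -> frob (A *m (u *m u^T)) ^+ 2 = frob (A *m u) ^+ 2.
Proof.
move=> uu; rewrite !frob_sqr_trace !trmx_mul trmxK !mulmxA.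
by rewrite -(mulmxA (A *m u)) uu mulmx1.
Qed.

Lemma projector_add_line n (P : 'M[R]_n) (u : 'cV[R]_n) :
  orthogonal_projector P -> u^T *m u = 1%:M -> P *m u = 0 ->
  orthogonal_projector (P + u *m u^T).
Proof.
move=> [PT PP] uu Pu; have [lT ll] := projector_line uu.
split; first by rewrite linearD /= PT lT.
have uP : u^T *m P = 0 by rewrite -[P]trmxK -trmx_mul PT Pu trmx0.
by rewrite mulmxDl !mulmxDr PP ll mulmxA Pu mul0mx -mulmxA uP mulmx0 addr0 add0r.
Qed.

End FrobeniusNorm.

(** * Deflation of the deficit by failed trials *)

Section Deflation.
Variables (R : realType) (d : nat) (L1 : R) (v : 'cV[R]_d) (A J0 : 'M[R]_d).
Variable xs : nat -> 'cV[R]_d.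
Hypothesis L1_gt0 : 0 < L1.

Local Notation proj r := (state v A J0 xs r).1.
Local Notation stp r := (step v xs r).
Local Notation fails r := (~~ test_passes L1 v A J0 xs r).

Definition deficit r : 'M[R]_d := A - model v A J0 xs r.

Definition new_part r : 'cV[R]_d := (1%:M - proj r) *m stp r.

Definition new_dir r : 'cV[R]_d := (enorm (new_part r))^-1 *: new_part r.

Lemma state_succ r :
  state v A J0 xs r.+1 =
  (proj r + new_dir r *m (new_dir r)^T,
   (state v A J0 xs r).2 +
     ((enorm (new_part r))^-1 *: (deficit r *m stp r)) *m (new_dir r)^T).
Proof.
rewrite /new_dir /new_part /deficit /model /=.
by case: (state _ _ _ _ r) => P C /=; rewrite (mulmxBl A).
Qed.

Lemma failed_gt r : fails r ->
  L1 / 2 * enorm (stp r) ^+ 2 < enorm (deficit r *m stp r).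
Proof. by rewrite /test_passes -ltNge /residual /deficit mulmxBl. Qed.

Lemma failed_deficit_step_neq0 r : fails r -> deficit r *m stp r != 0.
Proof.
move=> /failed_gt lt_e; rewrite -frob_gt0; apply: le_lt_trans lt_e.
by rewrite mulr_ge0 ?sqr_ge0 // divr_ge0 // ltW.
Qed.

Lemma failed_step_gt0 r : fails r -> 0 < enorm (stp r).
Proof.
move=> /failed_deficit_step_neq0; rewrite frob_gt0; apply: contraNneq => ->.
by rewrite mulmx0.
Qed.

Section OneTrial.
Variable r : nat.
Hypothesis r_fails : fails r.
Hypothesis proj_r : orthogonal_projector (proj r).
Hypothesis deficit_proj : deficit r *m proj r = 0.

(** The deficit vanishes on the directions already explored, so it sees only
the new part of the step. *)
Lemma deficit_new_part : deficit r *m new_part r = deficit r *m stp r.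
Proof. by rewrite mulmxA (mulmxBr _ 1%:M) mulmx1 deficit_proj subr0. Qed.

Lemma new_part_neq0 : new_part r != 0.
Proof.
have := failed_deficit_step_neq0 r_fails; rewrite -deficit_new_part.
by apply: contraNneq => ->; rewrite mulmx0.
Qed.

Lemma new_dir_unit : (new_dir r)^T *m new_dir r = 1%:M.
Proof. exact: unit_cV new_part_neq0. Qed.

Lemma proj_new_dir : proj r *m new_dir r = 0.
Proof.
by rewrite -scalemxAr mulmxA (mulmxBr _ 1%:M) mulmx1 proj_r.2 subrr mul0mx scaler0.
Qed.

(** The correction [e u^T / |w|] equals [deficit r *m (u *m u^T)], because the
residual [e] is the image of the new part [w] under the deficit. *)
Lemma deficit_succ :
  deficit r.+1 = deficit r *m (1%:M - new_dir r *m (new_dir r)^T).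
Proof.
rewrite {1}/deficit /model state_succ /= -deficit_new_part scalemxAr.
by rewrite mulmxBr mulmx1 mulmxA addrA opprD addrA.
Qed.

(** The failed test bounds the residual below by [L1 / 2] times the squared step,
and dividing by the length of [new_part r], which is at most the step as a
projection of it, cancels at most one of the two factors. *)
Lemma failed_loss :
  (L1 / 2) ^+ 2 * enorm (stp r) ^+ 2 < enorm (deficit r *m new_dir r) ^+ 2.
Proof.
have w_gt0 : 0 < enorm (new_part r) by rewrite frob_gt0 new_part_neq0.
have w_le : enorm (new_part r) <= enorm (stp r).
  exact/frob_projectorl_le/orthogonal_projectorC.
have e_gt := failed_gt r_fails; have s_gt0 := failed_step_gt0 r_fails.
have c_gt0 : 0 < L1 / 2 by rewrite divr_gt0.
rewrite -scalemxAr deficit_new_part frob_sqrZ -!exprMn.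
rewrite ltr_pXn2r ?nnegrE ?mulr_ge0 ?invr_ge0 ?frob_ge0 ?(ltW L1_gt0) //.
rewrite [ltRHS]mulrC ltr_pdivlMr //; apply: le_lt_trans e_gt.
by rewrite expr2 mulrA ler_pM2l // mulr_gt0.
Qed.

End OneTrial.

(** The directions found by failed trials are orthonormal, and each correction
makes the model exact along its direction without spoiling the earlier ones:
deflation along [u] kills [u], and it leaves the deficit unchanged on the
directions orthogonal to [u]. *)
Lemma deficit_projector r : (forall i, (i < r)%N -> fails i) ->
  orthogonal_projector (proj r) /\ deficit r *m proj r = 0.
Proof.
elim: r => [_|r IH fail_lt].
  by rewrite /orthogonal_projector /= trmx0 !mulmx0; split.
have [|oP DP] := IH; first by move=> i /ltnW; exact: fail_lt.
have r_fails := fail_lt _ (ltnSn r).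
have uu := new_dir_unit r_fails DP; have Pu := proj_new_dir oP.
rewrite (deficit_succ DP) state_succ /=; split; first exact: projector_add_line.
have uP : (new_dir r)^T *m proj r = 0.
  by rewrite -[proj r]trmxK -trmx_mul oP.1 Pu trmx0.
rewrite -mulmxA mulmxDr; have [_ ll] := projector_line uu.
rewrite !(mulmxBl 1%:M) !mul1mx ll subrr addr0 -mulmxA uP mulmx0 subr0.
exact: DP.
Qed.

(** Pythagoras at each deflation, telescoped over the failed trials. *)
Lemma sum_loss n : (forall i, (i < n)%N -> fails i) ->
  \sum_(i < n) enorm (deficit i *m new_dir i) ^+ 2 + frob (deficit n) ^+ 2
    = frob (deficit 0) ^+ 2.
Proof.
elim: n => [_|n IH fail_lt]; first by rewrite big_ord0 add0r.
have fail_lt' i (lt_in : (i < n)%N) : fails i := fail_lt i (ltnW lt_in).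
have [oP DP] := deficit_projector fail_lt'.
have uu := new_dir_unit (fail_lt n (ltnSn n)) DP.
rewrite -(IH fail_lt') big_ord_recr /= -addrA (deficit_succ DP).
rewrite -(frob_sqr_mul_line _ uu) -frob_sqr_projectorr //.
exact: projector_line.
Qed.

(** Each failure costs strictly more than its share of the budget, so the sum is
strictly bounded as soon as there is one failure. *)
Lemma sum_steps_lt n : (0 < n)%N -> (forall i, (i < n)%N -> fails i) ->
  \sum_(i < n) enorm (stp i) ^+ 2 < 4 / L1 ^+ 2 * frob (deficit 0) ^+ 2.
Proof.
move=> n_gt0 fail_lt; have c_gt0 : 0 < (L1 / 2) ^+ 2.
  by rewrite exprn_gt0 // divr_gt0.
have -> : 4 / L1 ^+ 2 = ((L1 / 2) ^+ 2)^-1.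
  by field; rewrite gt_eqF.
rewrite [ltRHS]mulrC ltr_pdivlMr // mulrC -(sum_loss fail_lt) ltr_wpDr ?sqr_ge0 //.
rewrite mulr_sumr; apply: ltr_sum => [|i _]; last first.
  have [|oP DP] := @deficit_projector i; last exact: failed_loss (fail_lt i _) _ _.
  by move=> j /ltn_trans lt_j; apply/fail_lt/lt_j.
by apply/hasP; exists (Ordinal n_gt0) => //; rewrite mem_index_enum.
Qed.

End Deflation.

(** * Counting trials *)

(** A run stops at the first passed test or at trial [d], which is not a test;
either way its last trial is not a failure. *)
Lemma failed_trials_run (R : realType) (d : nat) (Z : set 'cV[R]_d) (L1 : R)
    (Fv v : 'cV[R]_d) (A J0 : 'M[R]_d) (beta : R) (xs : nat -> 'cV[R]_d) n :
  refinement_run Z L1 Fv v A J0 beta xs n ->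
  failed_trials L1 v A J0 xs n = [set r : 'I_n.+1 | (r < n)%N]%SET.
Proof.
move=> [le_nd _ fail_lt last]; apply/setP => r; rewrite !inE.
have [lt_rn|le_nr] := ltnP r n; first by
  rewrite fail_lt // ltn_eqF // (leq_trans lt_rn).
have -> : r = n :> nat by apply/eqP; rewrite eqn_leq le_nr -ltnS ltn_ord.
by case: last => [->|->]; rewrite ?eqxx ?andbF.
Qed.

Lemma card_ord_lt n : #|[set r : 'I_n.+1 | (r < n)%N]%SET| = n.
Proof.
by rewrite -sum1dep_card -(big_ord_widen _ (fun=> 1%N)) // sum1_card card_ord.
Qed.

Lemma jvp_count_leS d n : (jvp_count d n <= n.+1)%N.
Proof. by rewrite -[leqRHS]card_ord max_card. Qed.

(** When the run reaches trial [d], that last trial uses no product. *)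
Lemma jvp_count_le_dim d n : (n <= d)%N -> (jvp_count d n <= d)%N.
Proof.
rewrite leq_eqVlt => /predU1P[->|]; last exact/leq_trans/jvp_count_leS.
rewrite -{3}(card_ord_lt d); apply/subset_leq_card/fintype.subsetP => r.
by rewrite !inE ltn_neqAle => ->; rewrite -ltnS ltn_ord.
Qed.

Theorem theorem4 (R : realType) (d M : nat) (Z : set 'cV[R]_d)
    (Z_nonempty : (Z !=set0)%classic) (Z_compact : compact Z)
    (Z_convex : convex_set Z)
    (w : 'I_M.+1 -> R) (w_gt0 : forall i, 0 < w i) (w_sum1 : \sum_i w i = 1)
    (Fi : 'I_M.+1 -> 'cV[R]_d -> 'cV[R]_d)
    (DFi : 'I_M.+1 -> 'cV[R]_d -> 'M[R]_d)
    (Fi_C1 : forall i, C1_on Z (Fi i) (DFi i)) (L1 : R) (L1_gt0 : 0 < L1)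
    (m : nat) (a b : 'I_m -> 'cV[R]_d)
    (aZ : forall j, Z (a j)) (bZ : forall j, Z (b j))
    (v : 'cV[R]_d) (vZ : Z v)
    (Sdag : 'M[R]_(m, d)) (B : 'M[R]_d) (x : nat -> 'cV[R]_d) (n : nat) :
  let F z := \sum_i w i *: Fi i z in
  let DF z := \sum_i w i *: DFi i z in
  let F1 := Fi ord0 in
  let DF1 := DFi ord0 in
  let G z := F z - F1 z in
  let beta := sup [set opnorm (DF z - DF1 z) | z in Z]%classic in
  let S := \matrix_(i < d, j < m) (b j - a j) i 0 in
  let Y := \matrix_(i < d, j < m) (G (b j) - G (a j)) i 0 in
  monotone_on Z F ->
  (forall y z, Z y -> Z z -> opnorm (DF y - DF z) <= L1 * enorm (y - z)) ->
  moore_penrose S Sdag ->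
  frob_projection beta (Y *m Sdag) B ->
  refinement_run Z L1 (F v) v (DF v) (DF1 v + B) beta x n ->
  let failed := failed_trials L1 v (DF v) (DF1 v + B) x n in
  let s := step v x in
  let q := jvp_count d n in
  let H := DF v - DF1 v - B in
  [/\ H != 0 -> \sum_(r in failed) enorm (s r) ^+ 2
                  < 4 / L1 ^+ 2 * frob H ^+ 2,
      H = 0 -> failed = finset.set0,
      failed = finset.set0 -> (q <= 1)%N
    & forall r0, r0 \in failed ->
        let tau := \big[Num.min/enorm (s r0)]_(r in failed) enorm (s r) in
        q%:R <= Num.min d%:R (1 + 4 * frob H ^+ 2 / (L1 ^+ 2 * tau ^+ 2))].
Proof.
move=> F DF F1 DF1 G beta S Y _ _ _ _ run failed s q H.
have [le_nd _ fail_lt _] := run.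
have H0 : deficit v (DF v) (DF1 v + B) x 0 = H.
  by rewrite /deficit /model /= addr0 opprD addrA.
have failedE : failed = [set r : 'I_n.+1 | (r < n)%N]%SET.
  exact: failed_trials_run run.
have n_eq0 : failed = finset.set0 -> n = 0%N.
  by move=> f0; rewrite -(card_ord_lt n) -failedE f0 cards0.
have failed0 : n = 0%N -> failed = finset.set0.
  by move=> n0; apply/eqP; rewrite -cards_eq0 failedE card_ord_lt n0.
have sum_lt : (0 < n)%N ->
    \sum_(r in failed) enorm (s r) ^+ 2 < 4 / L1 ^+ 2 * frob H ^+ 2.
  move=> n_gt0; have := sum_steps_lt L1_gt0 n_gt0 fail_lt.
  rewrite H0 (big_ord_widen n.+1 (fun i => enorm (s i) ^+ 2)) //.
  by rewrite failedE; under [X in _ -> X < _]eq_bigl do rewrite inE.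
have L2_gt0 : 0 < L1 ^+ 2 by rewrite exprn_gt0.
split.
- move=> H_neq0; have [n0|] := posnP n; last exact: sum_lt.
  by rewrite failed0 // big_set0 mulr_gt0 ?divr_gt0 ?exprn_gt0 ?frob_gt0.
- move=> H_eq0; have [/failed0//|/sum_lt] := posnP n.
  rewrite H_eq0 (_ : frob 0 = 0); last by apply/eqP; rewrite frob_eq0.
  by rewrite expr0n mulr0 ltNge sumr_ge0 // => r _; exact: sqr_ge0.
- by move=> /n_eq0 n0; rewrite /q n0 jvp_count_leS.
move=> r0 r0_failed; cbv zeta; set tau := \big[_/_]_(r in failed) _.
have lt_r0n : (r0 < n)%N by move: r0_failed; rewrite failedE inE.
have n_gt0 : (0 < n)%N by exact: leq_ltn_trans lt_r0n.
have s_gt0 r : r \in failed -> 0 < enorm (s r).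
  by rewrite failedE inE => /fail_lt; exact: failed_step_gt0.
have tau_gt0 : 0 < tau.
  rewrite /tau; apply: (big_ind (fun t => 0 < t)) => [|y z y0 z0|]; last exact: s_gt0.
    exact: s_gt0.
  by rewrite lt_min y0.
have n_tau : n%:R * tau ^+ 2 <= \sum_(r in failed) enorm (s r) ^+ 2.
  have -> : n%:R * tau ^+ 2 = \sum_(r in failed) tau ^+ 2.
    by rewrite sumr_const failedE card_ord_lt mulr_natl.
  apply: ler_sum => r r_failed; rewrite ler_pXn2r ?nnegrE ?frob_ge0 ?(ltW tau_gt0) //.
  exact: bigmin_le_cond.
(* [q <= n + 1], and the [n] failed steps are each at least [tau]. *)
rewrite le_min ler_nat jvp_count_le_dim //=.
apply: (@le_trans _ _ n.+1%:R); first by rewrite ler_nat jvp_count_leS.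
rewrite -natr1 addrC lerD2l ler_pdivlMr ?mulr_gt0 ?exprn_gt0 //.
have := le_trans n_tau (ltW (sum_lt n_gt0)).
by rewrite mulrAC ler_pdivlMr // -mulrA [tau ^+ 2 * _]mulrC.
Qed.
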